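(* Let $\mathcal{X},\mathcal{Y}$ be Banach spaces, $r_\star\in(0,\infty]$, and $\bar{x}\in\ell^1_\omega(\mathcal{X})$. Let $\mathcal{F}:\ell^1_\omega(\mathcal{X})\to\ell^1_\omega(\mathcal{Y})$ be a $C^1$ superposition operator associated with $F:\mathcal{X}\times[-1,1]\to\mathcal{Y}$. Let $\mathcal{A}=\mathcal{M}(A):\ell^1_\omega(\mathcal{Y})\to\ell^1_\omega(\mathcal{X})$ be a linear operator associated with $A:[-1,1]\to\mathcal{L}(\mathcal{Y},\mathcal{X})$, i.e. $[\mathcal{A}\psi](\lambda)=A(\lambda)\psi(\lambda)$ for all $\psi\in\ell^1_\omega(\mathcal{Y})$ and $\lambda\in[-1,1]$, where $A(\lambda)$ is injective for all $\lambda\in[-1,1]$. Assume that there exist positive constants $Y$, $Z_1$, $Z_2=Z_2(r_\star)$ satisfying $$\|\mathcal{A}\mathcal{F}(\bar{x})\|_{\ell^1_\omega(\mathcal{X})}\le Y,$$ $$\|\mathcal{I}-\mathcal{A}D\mathcal{F}(\bar{x})\|_{\mathcal{L}(\ell^1_\omega(\mathcal{X}),\ell^1_\omega(\mathcal{X}))}\le Z_1,$$ $$\|\mathcal{A}(D\mathcal{F}(x)-D\mathcal{F}(\bar{x}))\|_{\mathcal{L}(\ell^1_\omega(\mathcal{X}),\ell^1_\omega(\mathcal{X}))}\le Z_2\|x-\bar{x}\|_{\ell^1_\omega(\mathcal{X})}\quad\text{for all }x\in\mathcal{B}_{r_\star}(\bar{x}),$$ where $\mathcal{I}$ denotes the identity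 on $\ell^1_\omega(\mathcal{X})$. If there exists $r\in(0,r_\star]$ (with $r<\infty$) such that $$Y+rZ_1+\frac{r^2}{2}Z_2<r\qquad\text{and}\qquad Z_1+rZ_2<1,$$ then there exists a unique zero $x^\star$ of $\mathcal{F}$ in $\mathcal{B}_r(\bar{x})$. Moreover, for all $\lambda\in[-1,1]$, $x^\star(\lambda)$ is the unique zero of $F(\cdot,\lambda)$ in $B_r(\bar{x}(\lambda))$. In particular, there is no other branch of solutions of $F(x,\lambda)=0$ bifurcating from $x^\star$ in $\mathcal{X}$.
   Context: Weights: $\omega=(\omega_n)_{n\in\mathbb{N}}\in(0,\infty)^{\mathbb{N}}$ (with $0\in\mathbb{N}$) satisfies $\omega_0=1$, $\omega_n\ge1$ for all $n\ge1$, and $\omega_{|k+n|}\le\omega_{|k|}\omega_{|n|}$ for all $k,n\in\mathbb{Z}$. For a Banach space $\mathcal{X}$, $$\ell^1_\omega(\mathcal{X})=\Big\{\psi\in\mathcal{X}^{\mathbb{N}}:\ \|\psi\|_{\ell^1_\omega(\mathcal{X})}=\sum_{n\in\mathbb{Z}}\|\psi_{|n|}\|_{\mathcal{X}}\,\omega_{|n|}<\infty\Big\}.$$ A sequence $\psi\in\ell^1_\omega(\mathcal{X})$ is identified with the function $\psi:[-1,1]\to\mathcal{X}$, $\psi(\lambda)=\sum_{n\in\mathbb{Z}}\psi_{|n|}T_{|n|}(\lambda)$, where $T_n$ is the $n$-th Chebyshev polynomial of the first kind ($T_n(\cos t)=\cos(nt)$). A map $\mathcal{F}:\ell^1_\omega(\mathcal{X})\to\ell^1_\omega(\mathcal{Y})$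 is a superposition operator associated with $F:\mathcal{X}\times[-1,1]\to\mathcal{Y}$ if $[\mathcal{F}(x)](\lambda)=F(x(\lambda),\lambda)$ for all $x\in\ell^1_\omega(\mathcal{X})$ and $\lambda\in[-1,1]$. $\mathcal{L}(\mathcal{X},\mathcal{Y})$ is the Banach space of bounded linear operators from $\mathcal{X}$ to $\mathcal{Y}$. $B_r(x)$ denotes the closed ball of radius $r$ centered at $x$ in $\mathcal{X}$, and $\mathcal{B}_r(x)$ the closed ball of radius $r$ centered at $x$ in $\ell^1_\omega(\mathcal{X})$ (the whole space if the radius is $\infty$). $D$ denotes the Fréchet derivative. ''Another branch bifurcating from $x^\star$ in $\mathcal{X}$'' is understood in the usual sense: there would be some $\lambda_0\in[-1,1]$ and zeros $(x,\lambda)$ of $F$ with $x\ne x^\star(\lambda)$ arbitrarily close to $(x^\star(\lambda_0),\lambda_0)$ in $\mathcal{X}\times[-1,1]$. *)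

(* Defs.v *)
From HB Require Import structures.
From mathcomp Require Import all_boot all_order all_algebra.
From mathcomp Require Import all_classical all_reals all_analysis.

Set Implicit Arguments.
Unset Strict Implicit.
Unset Printing Implicit Defensive.

Import Order.TTheory GRing.Theory Num.Theory.
Import numFieldNormedType.Exports.

Local Open Scope classical_set_scope.
Local Open Scope ring_scope.

(* In integer indices, `|n|%N is the absolute value of n : int as a nat. *)

Record weight (R : realType) := Weight {
  weight_fun :> nat -> R ;
  weight_gt0 : forall n, 0 < weight_fun n ;
  weight0 : weight_fun 0%N = 1 ;
  weight_ge1 : forall n, (1 <= n)%N -> 1 <= weight_fun n ;
  weight_submul : forall k n : int,
    weight_fun `|(k + n)%R|%N <= weight_fun `|k|%N * weight_fun `|n|%N }.

Section ell1.
Context (R : realType) (w : weight R) (X : normedModType R).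
Implicit Type u v : nat -> X.

Definition ell1_enorm u : \bar R :=
  \esum_(n in [set: int]) (`|u `|n|%N| * w `|n|%N)%:E.

Definition ell1_pred : {pred nat -> X} := mem [set u | (ell1_enorm u < +oo)%E].

Record ell1 := Ell1 { ell1_seq :> nat -> X ; _ : ell1_seq \in ell1_pred }.

HB.instance Definition _ := [isSub for ell1_seq].
HB.instance Definition _ := [Choice of ell1 by <:].

Let term_ge0 u (n : int) : (0 <= (`|u `|n|%N| * w `|n|%N)%:E)%E.
Proof. by rewrite lee_fin mulr_ge0// ltW// weight_gt0. Qed.

Lemma ell1_enorm_ge0 u : (0 <= ell1_enorm u)%E.
Proof. by apply: esum_ge0 => n _; exact: term_ge0. Qed.

Lemma ell1_enormD u v :
  (ell1_enorm (u + v)%R <= ell1_enorm u + ell1_enorm v)%E.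
Proof.
rewrite /ell1_enorm -esumD; [|by move=> *; exact: term_ge0..].
apply: le_esum => n _; rewrite -EFinD lee_fin -mulrDl.
by rewrite ler_wpM2r ?ler_normD// ltW// weight_gt0.
Qed.

Let ell1_enormZ_le a u : (ell1_enorm (a *: u)%R <= `|a|%:E * ell1_enorm u)%E.
Proof.
apply: ge_ereal_sup => _ [A [finA AT]] <-.
rewrite (_ : (\sum_(n \in A) _)%E =
    (`|a|%:E * \sum_(n \in A) (`|u `|n|%N| * w `|n|%N)%:E)%E); last first.
  rewrite ge0_mule_fsumr; last by move=> n; exact: term_ge0.
  apply: eq_fsbigr => n _.
  rewrite -EFinM mulrA (_ : (a *: u) `|n|%N = a *: u `|n|%N)//.
  by rewrite normrZ.
rewrite lee_wpmul2l ?lee_fin//.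
by apply: ereal_sup_ubound; exists A.
Qed.

Lemma ell1_enormZ a u : ell1_enorm (a *: u)%R = (`|a|%:E * ell1_enorm u)%E.
Proof.
apply/eqP; rewrite eq_le ell1_enormZ_le/=.
have [->|a0] := eqVneq a 0; first by rewrite normr0 mul0e ell1_enorm_ge0.
rewrite -{1}[u](scalerK a0).
apply: (@le_trans _ _ (`|a|%:E * (`|a^-1|%:E * ell1_enorm (a *: u)%R))%E).
  by rewrite lee_wpmul2l ?lee_fin ?ell1_enormZ_le.
by rewrite muleA -EFinM normfV mulfV ?normr_eq0// mul1e.
Qed.

Lemma ell1_pred_submod_closed : submod_closed ell1_pred.
Proof.
split.
  rewrite inE/= (_ : ell1_enorm 0 = 0%E) ?ltry//.
  by rewrite -(scale0r (0 : nat -> X)) ell1_enormZ normr0 mul0e.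
move=> a u v; rewrite !inE/= => uoo voo.
apply: (le_lt_trans (ell1_enormD _ _)).
by rewrite lte_add_pinfty// ell1_enormZ lte_mul_pinfty ?lee_fin.
Qed.

HB.instance Definition _ :=
  GRing.isSubmodClosed.Build _ _ ell1_pred ell1_pred_submod_closed.
HB.instance Definition _ := [SubChoice_isSubLmodule of ell1 by <:].

Definition ell1_norm (u : ell1) : R := fine (ell1_enorm u).

Lemma ell1_normE (u : ell1) : (ell1_norm u)%:E = ell1_enorm u.
Proof.
rewrite /ell1_norm fineK// ge0_fin_numE ?ell1_enorm_ge0//.
by have := valP u; rewrite inE.
Qed.

Let ler_ell1_normD (u v : ell1) :
  ell1_norm (u + v) <= ell1_norm u + ell1_norm v.
Proof. by rewrite -lee_fin EFinD !ell1_normE ell1_enormD. Qed.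

Let ell1_normZ a (u : ell1) : ell1_norm (a *: u) = `|a| * ell1_norm u.
Proof. by apply: EFin_inj; rewrite EFinM !ell1_normE ell1_enormZ. Qed.

Let ell1_norm0_eq0 (u : ell1) : ell1_norm u = 0 -> u = 0.
Proof.
move=> u0; apply: val_inj; apply: funext => n /=; apply/eqP.
rewrite -normr_le0 -(pmulr_lle0 _ (weight_gt0 w n)) mulrC -lee_fin.
rewrite -[0 in leRHS]u0 ell1_normE; apply: esum_ge; exists [set n%:Z] => //.
by rewrite fsbig_set1 /= mulrC.
Qed.

HB.instance Definition _ := Lmodule_isNormed.Build R ell1
  ler_ell1_normD ell1_normZ ell1_norm0_eq0.

Lemma ell1_normrE (u : ell1) : `|u|%:E = ell1_enorm u.
Proof. exact: ell1_normE. Qed.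

End ell1.

(* chebyshev2 n is the pair (T_n, T_n.+1). *)
Fixpoint chebyshev2 (R : realType) (n : nat) : {poly R} * {poly R} :=
  if n is m.+1 then
    let: (p, q) := chebyshev2 R m in (q, 'X *+ 2 * q - p)
  else (1, 'X).

Definition chebyshev (R : realType) (n : nat) : {poly R} := (chebyshev2 R n).1.

Lemma chebyshev_cos (R : realType) (n : nat) (t : R) :
  (chebyshev R n).[cos t] = cos (t *+ n).
Proof.
suff: (chebyshev2 R n).1.[cos t] = cos (t *+ n) /\
      (chebyshev2 R n).2.[cos t] = cos (t *+ n.+1) by case.
elim: n => [|n] /=; first by rewrite !hornerE mulr0n cos0 mulr1n.
case: (chebyshev2 R n) => p q /= [pE qE]; split=> //.
rewrite !hornerE pE qE (mulrSr t n.+1) cosD.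
have -> : cos (t *+ n) = cos (t *+ n.+1 - t) by rewrite mulrSr addrK.
by rewrite cosB mulrDl (mulrC (cos t)) opprD addrACA addrN add0r.
Qed.

(* The value at l of the function attached to u, i.e. the sum over n in Z of
   u_|n| T_|n|(l), as the limit of the sums over |n| <= N; for l in [-1, 1] the
   series converges absolutely when X is complete. *)
Definition ell1_fun (R : realType) (w : weight R) (X : normedModType R)
    (u : ell1 w X) (l : R) : X :=
  lim ((fun N : nat => \sum_(n \in [set n : int | (`|n| <= N)%N])
          (chebyshev R `|n|%N).[l] *: u `|n|%N) @ \oo).

(* Functions of l in [-1, 1] are represented by functions on R of which only the
   values on [-1, 1] are ever constrained or used. *)
Definition superposition_operator (R : realType) (w : weight R)
    (X Y : normedModType R) (F : X -> R -> Y) (FF : ell1 w X -> ell1 w Y) :=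
  forall (x : ell1 w X) (l : R), l \in `[-1, 1] ->
    ell1_fun (FF x) l = F (ell1_fun x l) l.

Definition multiplication_operator (R : realType) (w : weight R)
    (Y X : normedModType R) (A : R -> {linear Y -> X})
    (AA : {linear ell1 w Y -> ell1 w X}) :=
  forall (psi : ell1 w Y) (l : R), l \in `[-1, 1] ->
    ell1_fun (AA psi) l = A l (ell1_fun psi l).

(* Operator norm of a linear map, equal to +oo exactly when it is unbounded, so
   that a real upper bound includes membership in L(V, W). *)
Definition opnorm (R : realType) (V W : normedModType R) (T : V -> W) : \bar R :=
  ereal_sup [set `|T v|%:E | v in [set v | `|v| <= 1]].

Definition continuously_differentiable (R : realType) (V W : normedModType R)
    (f : V -> W) :=
  (forall x, differentiable f x) /\
  (forall x, opnorm ('d f y \- 'd f x) @[y --> x] --> 0%E).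

Definition cball (R : realType) (V : normedModType R) (x : V) (r : \bar R) :
  set V := [set y | (`|y - x|%:E <= r)%E].

(* Another branch of zeros of F bifurcates from the curve l |-> xs l at some
   l0 in [-1, 1]. *)
Definition bifurcates (R : realType) (X Y : normedModType R)
    (F : X -> R -> Y) (xs : R -> X) :=
  exists2 l0 : R, l0 \in `[-1, 1] &
    closure [set p : X * R |
      [/\ p.2 \in `[-1, 1], F p.1 p.2 = 0 & p.1 <> xs p.2]] (xs l0, l0).

(* Main.v *)
Require Import Defs.
From HB Require Import structures.
From mathcomp Require Import all_boot all_order all_algebra.
From mathcomp Require Import all_classical all_reals all_analysis.
From mathcomp Require Import zify ring lra.

Set Implicit Arguments.
Unset Strict Implicit.
Unset Printing Implicit Defensive.

Import Order.TTheory GRing.Theory Num.Theory.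
Import numFieldNormedType.Exports.

Local Open Scope classical_set_scope.
Local Open Scope ring_scope.

(** The Newton map [T x = x - AA (FF x)] has derivative [I - AA DFF x], of norm at
most [Z1 + r Z2 < 1] on the ball of radius [r] around [xbar]
([newton_map_lipschitz]), and integrating the sharper bound
[Z1 + Z2 |x - xbar|] along rays shows that [T] maps this ball into a strictly
smaller one ([newton_map_dist_center]). Its fixed point [xs] satisfies
[AA (FF xs) = 0], hence [FF xs = 0], as [AA] inherits injectivity from the [A l].

This needs [AA] to be continuous, so that [T] is differentiable. That is the
content of [multiplication_operator_bound], which combines Banach-Steinhaus, for
which the completeness of the sequence space is established, with the control of
Chebyshev coefficients by values on [[-1, 1]] ([ell1_coef_le_sup]).

The pointwise uniqueness reflects that a strict contraction of the sequence space
which acts pointwise is a strict contraction at each parameter [l]: points of [X]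
lift isometrically to sequences which differ from [xbar] by a constant, and
evaluation at [l] does not increase norms ([superposition_unique_zero]).
Bifurcation is excluded because [xs] lies in the interior of the ball and
evaluates to a continuous curve: near the curve every zero of [F] is in the region
of uniqueness ([not_bifurcates_isolated]). *)

(** * A mean value inequality *)

Lemma derivable_increment (R : realType) (V : normedModType R) (f : R -> V)
    (df : V) (c : R) : is_derive c 1 f df ->
  forall e : R, 0 < e ->
  \forall t \near c, `|f t - f c - (t - c) *: df| <= e * `|t - c|.
Proof.
move=> [fc <-] e e0.
have /cvgrPdist_le /(_ e e0) := fc.
rewrite -/(derive f c 1) near_withinE => -[d d0 H].
exists d => // t /= tcd.
have [->|tc] := eqVneq t c.
  by rewrite !subrr scale0r subrr !normr0 mulr0.
have h0 : t - c != 0 by rewrite subr_eq0.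
have := H (t - c); rewrite /= sub0r normrN -(distrC c) => /(_ tcd h0).
rewrite /GRing.scale/= mulr1 subrK -ler_pdivrMr ?normr_gt0 1?subr_eq0 1?eq_sym//.
apply: le_trans.
rewrite (distrC c) (distrC ('D_1 f c)) mulrC -normfV -normrZ scalerBr scalerA.
by rewrite mulVf// scale1r.
Qed.

(** Vector-valued functions have no mean value equality, but the scalar proof
survives as a last-point argument: for each [e > 0] the set of [t] with
[|f t - f a| <= g t - g a + e (t - a)] is closed, and its supremum [c] cannot
lie below [b], as the derivatives at [c] carry the inequality further to the
right. A majorant [g] whose derivative varies is needed to get the quadratic
term of the Newton-Kantorovich estimate with its factor [1/2]. *)
Lemma mean_value_inequality (R : realType) (V : normedModType R)
    (f df : R -> V) (g dg : R -> R) (a b : R) : a <= b ->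
  (forall t, t \in `[a, b] -> is_derive t 1 f (df t)) ->
  (forall t, t \in `[a, b] -> is_derive t 1 g (dg t)) ->
  (forall t, t \in `[a, b] -> `|df t| <= dg t) ->
  `|f b - f a| <= g b - g a.
Proof.
move=> ab fD gD dfg.
suff key (e : R) : 0 < e -> `|f b - f a| <= g b - g a + e * (b - a).
  apply/ler_addgt0Pr => e e0.
  have ba1 : 0 < b - a + 1 by rewrite ltr_wpDl ?subr_ge0.
  apply: (le_trans (key (e / (b - a + 1)) (divr_gt0 e0 ba1))).
  rewrite lerD2l -mulrA; apply: ler_piMr; first exact: ltW.
  by rewrite mulrC ler_pdivrMr// mul1r lerDl.
move=> e0.
pose phi t := `|f t - f a| - (g t - g a) - e * (t - a).
pose Z := [set t | t \in `[a, b] /\ phi t <= 0].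
have Za : Z a.
  split; first by rewrite in_itv/= lexx.
  by rewrite /phi subrr normr0; lra.
have Zsup : has_sup Z.
  by split; [exists a|exists b => t [/[!in_itv]/= /andP[]]].
pose c := sup Z.
have ac : a <= c by apply: (ub_le_sup Zsup.2).
have cb : c <= b.
  by apply: (ge_sup Zsup.1) => t [/[!in_itv]/= /andP[]].
have cab : c \in `[a, b] by rewrite in_itv/= ac cb.
have phic : {for c, continuous phi}.
  have fc : {for c, continuous f}.
    by apply: differentiable_continuous; apply/derivable1_diffP; have [] := fD c cab.
  have gc : {for c, continuous g}.
    by apply: differentiable_continuous; apply/derivable1_diffP; have [] := gD c cab.
  apply: cvgB; first apply: cvgB.
  - by apply: cvg_norm; apply: cvgB => //; exact: cvg_cst.
  - by apply: cvgB => //; exact: cvg_cst.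
  - by apply: cvgM; [exact: cvg_cst|apply: cvgB; [exact: cvg_id|exact: cvg_cst]].
have phic0 : phi c <= 0.
  rewrite leNgt; apply/negP => phi0.
  have /cvgrPdist_lt /(_ _ phi0) [d /= d0 H] := phic.
  have [t [tab pt] ct] := sup_adherent d0 Zsup.
  have tc : t <= c by apply: (ub_le_sup Zsup.2).
  have := H t; rewrite /= ger0_norm ?subr_ge0// ltrBlDr -ltrBlDl => /(_ ct).
  by rewrite ltr_norml => /andP[_]; rewrite ltrBlDr ltrDl ltNge pt.
move: cb; rewrite le_eqVlt => /predU1P[<-|cb].
  by move: phic0; rewrite /phi; lra.
have e20 : 0 < e / 2 by rewrite divr_gt0.
have [d1 /= d10 H1] := derivable_increment (fD c cab) e20.
have [d2 /= d20 H2] := derivable_increment (gD c cab) e20.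
pose d := Num.min (Num.min d1 d2) (b - c).
have d0 : 0 < d by rewrite /d !lt_min d10 d20 subr_gt0 cb.
pose t := c + d / 2.
have tcE : t - c = d / 2 by rewrite /t addrAC subrr add0r.
have tc0 : 0 < t - c by rewrite tcE divr_gt0.
have tcd : t - c < d by rewrite tcE ltr_pdivrMr// ltr_pMr// ltr1n.
have [td1 td2 tb] : [/\ t - c < d1, t - c < d2 & t - c < b - c].
  by move: tcd; rewrite /d !lt_min => /andP[/andP[-> ->] ->].
have tcn : `|c - t| = t - c by rewrite distrC gtr0_norm.
have := H1 t; rewrite /= tcn (gtr0_norm tc0) => /(_ td1) Hf.
have := H2 t; rewrite /= tcn (gtr0_norm tc0) => /(_ td2) Hg.
have Zt : Z t.
  split; first by rewrite in_itv/=; apply/andP; split; lra.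
  have h1 : `|f t - f a| <= `|f c - f a| + `|f t - f c|.
    by rewrite -[f t - f a](subrKA (f c)) addrC; exact: ler_normD.
  have h2 : `|f t - f c| <= (t - c) * dg c + e / 2 * (t - c).
    rewrite -[f t - f c](subrK ((t - c) *: df c)) addrC.
    apply: (le_trans (ler_normD _ _)); apply: lerD => //.
    by rewrite normrZ gtr0_norm// ler_pM2l// dfg.
  move: Hg; rewrite ler_norml /GRing.scale/= => /andP[+ _].
  by move: phic0; rewrite /phi; nra.
have : t <= c by apply: (ub_le_sup Zsup.2).
by rewrite leNgt -subr_gt0 tc0.
Qed.

(** * The weighted sequence space as a Banach space *)

Lemma finite_int_ball (N : nat) : finite_set [set n : int | (`|n| <= N)%N].
Proof.
apply: (@sub_finite_set _ _ ([set Posz n | n in `I_N.+1] `|`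
   [set - Posz n | n in `I_N.+1])); last first.
  by rewrite finite_setU; split; apply: finite_image; exact: finite_II.
move=> n /= nN; have [n0|n0] := lerP 0 n; [left|right].
  by exists `|n|%N => //; rewrite gez0_abs.
by exists `|n|%N => //; rewrite ltz0_abs// opprK.
Qed.

Lemma sum_int_ball (V : zmodType) (f : nat -> V) (N : nat) :
  \sum_(n \in [set n : int | (`|n| <= N)%N]) f `|n|%N =
  \sum_(n < N.+1) f n *+ (n != 0%N :> nat).+1.
Proof.
elim: N => [|N IH].
  rewrite big_ord1 (_ : [set _ | _] = [set 0%Z]) ?fsbig_set1//.
  by apply/seteqP; split => [n /=|n /= ->//]; lia.
rewrite big_ord_recr/= -IH (_ : [set n : int | (`|n| <= N.+1)%N] =
  [set n : int | (`|n| <= N)%N] `|` ([set N.+1%:Z] `|` [set - N.+1%:Z])); last first.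
  by apply/seteqP; split => [n /=|n /=]; lia.
rewrite fsbigU0//=; first last.
- by move=> n /= [nN [] nE]; lia.
- exact: finite_int_ball.
rewrite fsbigU0//=; last by move=> n /= [-> nE]; lia.
by rewrite !fsbig_set1 abszN absz_nat mulr2n.
Qed.

Section ell1_sums.
Context {R : realType} (w : weight R) {X : normedModType R}.
Implicit Type u v : nat -> X.

(** The sum of the weighted norms over the integers of absolute value at most
[N], with [n] and [- n] folded into one term of multiplicity [(n != 0).+1]. All
estimates on the norm, which is a supremum over finite sets of integers, go
through these partial sums indexed by [nat]. *)
Definition ell1_psum u (N : nat) : R :=
  \sum_(n < N.+1) (`|u n| * w n) *+ (n != 0%N :> nat).+1.

Lemma ell1_psumE u N : (ell1_psum u N)%:E =
  (\sum_(n \in [set n : int | (`|n| <= N)%N]) (`|u `|n|%N| * w `|n|%N)%:E)%E.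
Proof.
rewrite /ell1_psum -(sum_int_ball (fun n => `|u n| * w n)).
by rewrite !fsbig_finite ?sumEFin//; exact: finite_int_ball.
Qed.

Lemma ell1_psum_le_enorm u N : ((ell1_psum u N)%:E <= ell1_enorm w u)%E.
Proof.
rewrite ell1_psumE; apply: ereal_sup_ubound.
by eexists; [split; [exact: (finite_int_ball N)|]|].
Qed.

(** Every finite set of integers lies in some symmetric interval, so bounding
the partial sums bounds the whole norm; this is how membership in the space and
norm estimates are obtained below. *)
Lemma ell1_enorm_le u (C : R) : (forall N, ell1_psum u N <= C) ->
  (ell1_enorm w u <= C%:E)%E.
Proof.
move=> uC; apply: ge_ereal_sup => _ [A [finA _]] <-.
pose N := (\max_(n <- finmap.enum_fset (fset_set A)) `|n|)%N.
apply: (@le_trans _ _ (ell1_psum u N)%:E); last by rewrite lee_fin.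
rewrite ell1_psumE; apply: lee_fsum_nneg_subset => //.
- exact: finite_int_ball.
- move=> n nA; rewrite inE/= /N.
  by rewrite (bigD1_seq n) ?in_fset_set ?leq_maxl ?fset_uniq.
- by move=> n _; rewrite lee_fin mulr_ge0// ltW// weight_gt0.
Qed.

End ell1_sums.

Lemma ell1_psum_homo (R : realType) (w : weight R) (X : normedModType R)
    (u : nat -> X) : {homo ell1_psum w u : M N / (M <= N)%N >-> M <= N}.
Proof.
move=> M N MN; rewrite /ell1_psum -(subnKC MN) -addSn big_split_ord/= lerDl.
by apply: sumr_ge0 => n _; rewrite mulrn_wge0// mulr_ge0// ltW// weight_gt0.
Qed.

Section ell1_space.
Context {R : realType} {w : weight R} {X : normedModType R}.
Implicit Type u v : ell1 w X.

Lemma ell1_psum_le u N : ell1_psum w u N <= `|u|.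
Proof. by rewrite -lee_fin ell1_normrE ell1_psum_le_enorm. Qed.

Lemma ell1_norm_le u (C : R) : (forall N, ell1_psum w u N <= C) -> `|u| <= C.
Proof. by move=> uC; rewrite -lee_fin ell1_normrE ell1_enorm_le. Qed.

Lemma ell1_pred_psum (u : nat -> X) (C : R) :
  (forall N, ell1_psum w u N <= C) -> u \in @ell1_pred R w X.
Proof.
by move=> uC; rewrite inE /=; exact: le_lt_trans (ell1_enorm_le uC) (ltry _).
Qed.

Lemma weight_fun_ge1 n : 1 <= w n.
Proof. by case: n => [|n]; rewrite ?weight0// weight_ge1. Qed.

Lemma ell1_coef_le u n : `|u n| <= `|u|.
Proof.
apply: le_trans (ell1_psum_le u n).
rewrite /ell1_psum big_ord_recr/= -[leLHS]add0r; apply: lerD.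
  by apply: sumr_ge0 => i _; rewrite mulrn_wge0// mulr_ge0// ltW// weight_gt0.
apply: (@le_trans _ _ (`|u n| * w n)); first by rewrite ler_peMr// weight_fun_ge1.
by rewrite mulrS lerDl mulrn_wge0// mulr_ge0// ltW// weight_gt0.
Qed.

Definition trunc_seq (N : nat) (u : nat -> X) (n : nat) : X :=
  if (n <= N)%N then u n else 0.

Lemma ell1_psum_trunc_split (N : nat) (u : nat -> X) K : ell1_psum w u K =
  ell1_psum w (trunc_seq N u) K + ell1_psum w (u - trunc_seq N u) K.
Proof.
rewrite /ell1_psum -big_split/=; apply: eq_bigr => n _.
rewrite -mulrnDl -mulrDl; congr (_ * _ *+ _).
rewrite (_ : (u - trunc_seq N u) n = u n - trunc_seq N u n)// /trunc_seq.
case: ifP => _.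
  by rewrite subrr normr0 addr0.
by rewrite subr0 normr0 add0r.
Qed.

Lemma ell1_psum_trunc (N : nat) (u : nat -> X) K : (N <= K)%N ->
  ell1_psum w (trunc_seq N u) K = ell1_psum w u N.
Proof.
move=> NK; rewrite /ell1_psum -(subnKC NK) -addSn big_split_ord/=.
rewrite [X in _ + X]big1 => [|i _]; last first.
  by rewrite /trunc_seq ltn_geF ?ltnS ?leq_addr// normr0 mul0r mul0rn.
rewrite addr0; apply: eq_bigr => i _.
by rewrite /trunc_seq -ltnS ltn_ord.
Qed.

Lemma ell1_psum_trunc_le (N : nat) (u : nat -> X) K :
  ell1_psum w (trunc_seq N u) K <= ell1_psum w u N.
Proof.
rewrite -(ell1_psum_trunc u (leq_maxr K N)).
by apply: ell1_psum_homo; exact: leq_maxl.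
Qed.

Definition ell1_trunc (N : nat) (u : nat -> X) : ell1 w X :=
  Ell1 (ell1_pred_psum (ell1_psum_trunc_le N u)).

Lemma norm_ell1_trunc_le (N : nat) (u : nat -> X) :
  `|ell1_trunc N u| <= ell1_psum w u N.
Proof. by apply: ell1_norm_le => K; exact: ell1_psum_trunc_le. Qed.

Lemma ell1_trunc_linear (N : nat) : linear (ell1_trunc N : ell1 w X -> ell1 w X).
Proof.
move=> a u v; apply: val_inj; apply/funext => n.
change ((if (n <= N)%N then a *: u n + v n else 0) =
  a *: trunc_seq N u n + trunc_seq N v n).
by rewrite /trunc_seq; case: ifP => _ //; rewrite scaler0 addr0.
Qed.

(** Finitely supported sequences are dense. Their associated functions are
polynomials, which reduces continuity of evaluation and recovery of the
coefficients to finite sums. *)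
Lemma ell1_trunc_approx u (e : R) : 0 < e ->
  \forall N \near \oo, `|u - ell1_trunc N u| <= e.
Proof.
move=> e0; have [M uM] : exists M, `|u| - e < ell1_psum w u M.
  apply: contrapT => /forallNP H.
  have /ell1_norm_le : forall N, ell1_psum w u N <= `|u| - e.
    by move=> N; rewrite leNgt; exact/negP/H.
  by rewrite lerBrDl gerDr leNgt e0.
exists M => // N /= MN; apply: ell1_norm_le => K.
have {}uM := lt_le_trans uM (ell1_psum_homo w u MN).
apply: le_trans (ell1_psum_homo _ _ (leq_maxl K N)) _.
have := ell1_psum_trunc_split N u (maxn K N).
rewrite ell1_psum_trunc ?leq_maxr// => E.
have := ell1_psum_le u (maxn K N); rewrite E.
rewrite (_ : ell1_psum w (u - ell1_trunc N u) _ =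
  ell1_psum w ((u : nat -> X) - trunc_seq N u) (maxn K N))//.
lra.
Qed.

Definition ell1_const (z : X) : ell1 w X := ell1_trunc 0 (fun=> z).

Lemma ell1_constB z z' : ell1_const (z - z') = ell1_const z - ell1_const z'.
Proof.
apply: val_inj; apply/funext => n.
change ((if (n <= 0)%N then z - z' else 0) =
  trunc_seq 0 (fun=> z) n - trunc_seq 0 (fun=> z') n).
by rewrite /trunc_seq; case: ifP => // _; rewrite subrr.
Qed.

(** Constants embed isometrically because [w 0 = 1]. This is what transfers
statements between [X] and the sequence space at a fixed parameter. *)
Lemma norm_ell1_const z : `|ell1_const z| = `|z|.
Proof.
apply/eqP; rewrite eq_le; apply/andP; split.
  apply: (le_trans (norm_ell1_trunc_le _ _)).
  by rewrite /ell1_psum big_ord1/= weight0 mulr1.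
exact: (ell1_coef_le (ell1_const z) 0).
Qed.

End ell1_space.

Section ell1_complete.
Context {R : realType} {w : weight R} {X : completeNormedModType R}.

Lemma ell1_psum_cvg (T : Type) (G : set_system T) {GF : Filter G}
    (f : T -> nat -> X) (v : nat -> X) (N : nat) :
  (forall n, f x n @[x --> G] --> v n) ->
  ell1_psum w (f x) N @[x --> G] --> ell1_psum w v N.
Proof.
move=> fv; apply: cvg_big => [|n _]; first exact: add_continuous.
by apply: cvgMn; apply: cvgM; [apply: cvg_norm; exact: fv|exact: cvg_cst].
Qed.

(** A Cauchy filter converges coefficientwise, and a bound on the partial sums
of [u - y] valid for all [y] in a small ball passes to the coefficientwise limit,
which is therefore also a limit in norm. *)
Lemma ell1_cauchy_cvg (G : set_system (ell1 w X)) :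
  ProperFilter G -> cauchy G -> cvg G.
Proof.
move=> GF /cauchyP Gc.
pose v (n : nat) : X := lim ((fun u : ell1 w X => u n) @ G).
have coefv (n : nat) : (fun u : ell1 w X => u n) @ G --> v n.
  apply: cauchy_cvg; apply/cauchyP => e e0; have [u Gu] := Gc e e0.
  exists (u n); change (G (fun y : ell1 w X => ball (u n) e (y n))).
  apply: filterS Gu => y; rewrite -!ball_normE /=.
  exact: (le_lt_trans (ell1_coef_le (u - y) n)).
have near_v (e : R) : 0 < e -> exists u : ell1 w X, G (ball u e) /\
    forall N, ell1_psum w ((u : nat -> X) - v) N <= e.
  move=> e0; have [u Gu] := Gc e e0; exists u; split => // N.
  have /cvg_lim <-// : ell1_psum w ((u : nat -> X) - (y : nat -> X)) N @[y --> G]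
      --> ell1_psum w ((u : nat -> X) - v) N.
    by apply: ell1_psum_cvg => n; apply: cvgB; [exact: cvg_cst|exact: coefv].
  apply: limr_le.
    apply/cvg_ex; eexists; apply: ell1_psum_cvg => n.
    by apply: cvgB; [exact: cvg_cst|exact: coefv].
  suff : G (fun y : ell1 w X =>
      ell1_psum w ((u : nat -> X) - (y : nat -> X)) N <= e) by [].
  apply: filterS Gu => y; rewrite -ball_normE /= => /ltW.
  exact: (le_trans (ell1_psum_le (u - y) N)).
have [u0 [_ /ell1_pred_psum u0v]] := near_v 1 ltr01.
pose v' : ell1 w X := u0 - Ell1 u0v.
have v'E n : v' n = v n by rewrite /v' /= [LHS]subKr.
apply/cvg_ex; exists v'; apply/cvgrPdist_lt => e e0.
have [u [Gu uv]] := near_v (e / 2) (divr_gt0 e0 (ltr0Sn _ _)).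
apply: filterS Gu => y; rewrite -ball_normE /= => uy.
rewrite -(subrKA u) (splitr e).
apply: (le_lt_trans (ler_normD _ _)); apply: ler_ltD => //.
rewrite distrC; apply: ell1_norm_le => N; apply: le_trans (uv N).
rewrite le_eqVlt; apply/orP; left; apply/eqP.
by congr ell1_psum; apply/funext => n; change (u n - v' n = u n - v n); rewrite v'E.
Qed.

HB.instance Definition _ := Uniform_isComplete.Build (ell1 w X) ell1_cauchy_cvg.

End ell1_complete.

(** * Evaluation of Chebyshev series *)

Lemma norm_chebyshev_le1 (R : realType) (n : nat) (l : R) :
  l \in `[-1, 1] -> `|(Defs.chebyshev R n).[l]| <= 1.
Proof.
move=> l11; rewrite -(acosK l11) chebyshev_cos.
exact: cos_max.
Qed.

Section evaluation.
Context {R : realType} {w : weight R} {X : completeNormedModType R}.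
Implicit Type u v : ell1 w X.

Definition cheb_psum (u : nat -> X) (l : R) (N : nat) : X :=
  \sum_(n < N.+1) ((Defs.chebyshev R n).[l] *: u n) *+ (n != 0%N :> nat).+1.

Lemma ell1_funE u l : ell1_fun u l = lim (cheb_psum u l @ \oo).
Proof.
rewrite /ell1_fun; congr (lim (_ @ \oo)); apply/funext => N.
exact: (sum_int_ball (fun n => (Defs.chebyshev R n).[l] *: u n)).
Qed.

Lemma norm_cheb_psum_le (u : nat -> X) l N : l \in `[-1, 1] ->
  `|cheb_psum u l N| <= ell1_psum w u N.
Proof.
move=> l11; apply: (le_trans (ler_norm_sum _ _ _)); apply: ler_sum => n _.
rewrite normrMn lerMn2r; apply/orP; right.
rewrite normrZ mulrC ler_wpM2l//.
by rewrite (le_trans (norm_chebyshev_le1 _ l11))// weight_fun_ge1.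
Qed.

Lemma cheb_psum_cvg u l : l \in `[-1, 1] -> cheb_psum u l @ \oo --> ell1_fun u l.
Proof.
move=> l11; rewrite ell1_funE.
pose f n := ((Defs.chebyshev R n).[l] *: u n) *+ (n != 0%N :> nat).+1.
have fE : cheb_psum u l = (fun N => series f N.+1).
  by apply/funext => N; rewrite /cheb_psum seriesEord.
suff /cvg_ex[s fs] : cvgn (series f).
  have fSs : (fun N => series f N.+1) @ \oo --> s by rewrite (cvg_shiftS (series f)).
  by rewrite fE (cvg_lim _ fSs).
apply: normed_cvg.
apply: nondecreasing_is_cvgn.
  by apply: nondecreasing_series => n _ _; exact: normr_ge0.
exists `|u| => _ [N _ <-]; rewrite /= /series /= big_mkord.
apply: le_trans (ell1_psum_le u N).
rewrite /ell1_psum big_ord_recr/= -[leLHS]addr0; apply: lerD; last first.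
  by rewrite mulrn_wge0// mulr_ge0// ltW// weight_gt0.
apply: ler_sum => n _; rewrite /f normrMn lerMn2r; apply/orP; right.
rewrite normrZ mulrC ler_wpM2l//.
by rewrite (le_trans (norm_chebyshev_le1 _ l11))// weight_fun_ge1.
Qed.

(** Evaluation is a contraction since [|T_n| <= 1] on [[-1, 1]] and the weights
are at least [1]. *)
Lemma norm_ell1_fun_le u l : l \in `[-1, 1] -> `|ell1_fun u l| <= `|u|.
Proof.
move=> l11.
have H : `|cheb_psum u l N| @[N --> \oo] --> `|ell1_fun u l|.
  by apply: cvg_norm; exact: cheb_psum_cvg.
rewrite -(cvg_lim _ H)//; apply: limr_le; first by apply/cvg_ex; eexists; exact: H.
apply: nearW => N.
exact: le_trans (norm_cheb_psum_le _ _ l11) (ell1_psum_le u N).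
Qed.

Lemma ell1_fun_linear l : l \in `[-1, 1] ->
  linear (fun u : ell1 w X => ell1_fun u l).
Proof.
move=> l11 a u v; apply: cvg_lim => //.
rewrite (_ : (fun N : nat => _) = a \*: cheb_psum u l \+ cheb_psum v l).
  apply: cvgD; last exact: cheb_psum_cvg.
  by apply: cvgZ; [exact: cvg_cst|exact: cheb_psum_cvg].
apply/funext => N /=; rewrite (sum_int_ball (fun n => (Defs.chebyshev R n).[l] *: _ n)).
rewrite /cheb_psum scaler_sumr -big_split/=; apply: eq_bigr => n _.
rewrite -scalerMnr -mulrnDl; congr (_ *+ _).
change ((Defs.chebyshev R n).[l] *: (a *: u n + v n) =
  a *: ((Defs.chebyshev R n).[l] *: u n) + (Defs.chebyshev R n).[l] *: v n).
by rewrite scalerDr !scalerA mulrC.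
Qed.

Lemma ell1_fun0 l : l \in `[-1, 1] -> ell1_fun (0 : ell1 w X) l = 0.
Proof.
by move=> l11; apply/eqP; rewrite -normr_le0 -[leRHS](normr0 (ell1 w X)) norm_ell1_fun_le.
Qed.

Lemma ell1_funD u v l : l \in `[-1, 1] ->
  ell1_fun (u + v) l = ell1_fun u l + ell1_fun v l.
Proof. by move=> l11; have := ell1_fun_linear l11 1 u v; rewrite !scale1r. Qed.

Lemma ell1_funB u v l : l \in `[-1, 1] ->
  ell1_fun (u - v) l = ell1_fun u l - ell1_fun v l.
Proof.
move=> l11; have := ell1_fun_linear l11 (-1) v u; rewrite /= !scaleN1r (addrC u) => ->.
by rewrite addrC.
Qed.

Lemma ell1_fun_trunc (N : nat) (u : nat -> X) l :
  ell1_fun (ell1_trunc N u : ell1 w X) l = cheb_psum u l N.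
Proof.
rewrite ell1_funE; apply: lim_near_cst => //.
near=> K; have NK : (N <= K)%N by near: K; exact: nbhs_infty_ge.
rewrite /cheb_psum -(subnKC NK) -addSn big_split_ord/=.
rewrite [X in _ + X]big1 => [|i _]; last first.
  by rewrite /trunc_seq ltn_geF ?ltnS ?leq_addr// scaler0 mul0rn.
rewrite addr0; apply: eq_bigr => i _.
by rewrite /trunc_seq -ltnS ltn_ord.
Unshelve. all: by end_near. Qed.

Lemma ell1_fun_const (z : X) l : ell1_fun (ell1_const z : ell1 w X) l = z.
Proof.
by rewrite /ell1_const ell1_fun_trunc /cheb_psum big_ord1/= /Defs.chebyshev /= hornerE scale1r.
Qed.

Lemma ell1_fun_near u (l e : R) : l \in `[-1, 1] -> 0 < e ->
  \forall m \near l, m \in `[-1, 1] -> `|ell1_fun u l - ell1_fun u m| < e.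
Proof.
move=> l11 e0; have e30 : 0 < e / 3 by rewrite divr_gt0.
have [N _ /(_ N (leqnn N)) uN] := ell1_trunc_approx u e30.
have cheb_cont : cheb_psum u m N @[m --> l] --> cheb_psum u l N.
  apply: cvg_big => [|n _]; first exact: add_continuous.
  by apply: cvgMn; apply: cvgZ; [exact: continuous_horner|exact: cvg_cst].
move/cvgrPdist_lt : cheb_cont => /(_ _ e30).
apply: filterS => m ulm m11.
have trunc_dist k : k \in `[-1, 1] -> `|ell1_fun u k - cheb_psum u k N| <= e / 3.
  move=> k11; rewrite -ell1_fun_trunc -ell1_funB//.
  exact: le_trans (norm_ell1_fun_le _ k11) uN.
rewrite -(subrKA (cheb_psum u l N)) -(subrKA (cheb_psum u m N) (cheb_psum u l N)).
apply: (le_lt_trans (ler_normD _ _)).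
have := trunc_dist _ l11; have := trunc_dist _ m11; rewrite (distrC _ (cheb_psum _ _ _)).
have := ler_normD (cheb_psum u l N - cheb_psum u m N) (cheb_psum u m N - ell1_fun u m).
lra.
Qed.

End evaluation.

(** * Recovering the coefficients *)

Section discrete_cosines.
Context {R : realType}.

Definition node (K j : nat) : R := 2 * pi * j%:R / K%:R.

(** Multiplied by [2 sin (k pi / K)], the sum telescopes to a difference of two
values of [sin] that are [2 k pi] apart. *)
Lemma sum_cos_node (K k : nat) : (0 < k < K)%N ->
  \sum_(j < K) cos (node K j *+ k) = 0 :> R.
Proof.
move=> /andP[k0 kK]; have K0 : (0 < K)%N by exact: ltn_trans kK.
have KR0 : 0 < K%:R :> R by rewrite ltr0n.
pose a : R := pi * k%:R / K%:R.
have sa0 : 0 < sin a.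
  apply: sin_gt0_pi; rewrite divr_gt0 ?mulr_gt0 ?pi_gt0 ?ltr0n//=.
  by rewrite ltr_pdivrMr// ltr_pM2l ?pi_gt0// ltr_nat.
pose g (j : nat) : R := sin (a *+ j.*2 - a).
have gE (j : nat) : 2 * sin a * cos (node K j *+ k) = g j.+1 - g j.
  have -> : node K j *+ k = a *+ j.*2.
    by rewrite /node /a -[LHS]mulr_natr -[RHS]mulr_natr -mul2n natrM; field; lra.
  rewrite /g doubleS -(addn2 j.*2) mulrnDr.
  have -> : a *+ j.*2 + a *+ 2 - a = a *+ j.*2 + a by rewrite mulr2n; ring.
  by rewrite sinD sinB; ring.
have : 2 * sin a * \sum_(j < K) cos (node K j *+ k) = 0.
  rewrite mulr_sumr -(big_mkord xpredT (fun j => 2 * sin a * cos (node K j *+ k))).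
  under eq_bigr do rewrite gE.
  rewrite telescope_sumr// /g mulr0n sub0r sinN opprK.
  have -> : a *+ K.*2 = pi *+ 2 *+ k.
    rewrite /a -[LHS]mulr_natr -mulrnA -[RHS]mulr_natr -muln2 mulnC !natrM.
    by field; lra.
  by rewrite (addrC (_ *+ k)) (periodicn (@sinD2pi R)) sinN addNr.
by move=> /eqP; rewrite !mulf_eq0 pnatr_eq0/= (gt_eqF sa0)/= => /eqP.
Qed.

Lemma sum_cos_nodeE (K k : nat) : (k < K)%N ->
  \sum_(j < K) cos (node K j *+ k) = K%:R *+ (k == 0%N) :> R.
Proof.
case: k => [_|k kK]; last by rewrite sum_cos_node.
under eq_bigr do rewrite mulr0n cos0.
by rewrite sumr_const card_ord.
Qed.

Lemma cosM_cos (t : R) (n m : nat) : 2 * (cos (t *+ n) * cos (t *+ m)) =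
  cos (t *+ (n + m)) + cos (t *+ (maxn n m - minn n m)).
Proof.
wlog nm : n m / (n <= m)%N.
  move=> H; case/orP: (leq_total n m) => [/H//|/H mn].
  by rewrite (mulrC (cos _)) mn addnC maxnC minnC.
rewrite (maxn_idPr nm) (minn_idPl nm) mulrnBr// cosB mulrnDr cosD; ring.
Qed.

(** Orthogonality of the cosines for the uniform measure on the [K]-th roots of
unity; [n + m < K] excludes aliasing. The multiplicity of the index [m] makes the
right-hand side uniform in [m]. *)
Lemma discrete_orthogonality (K n m : nat) : (n + m < K)%N ->
  (\sum_(j < K) cos (node K j *+ n) * cos (node K j *+ m)) *+ (m != 0%N).+1 =
  K%:R *+ (m == n) :> R.
Proof.
move=> nmK.
have : 2 * (\sum_(j < K) cos (node K j *+ n) * cos (node K j *+ m)) =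
    K%:R *+ (n + m == 0)%N + K%:R *+ (maxn n m - minn n m == 0)%N :> R.
  rewrite mulr_sumr; under eq_bigr do rewrite cosM_cos.
  rewrite big_split/= !sum_cos_nodeE//; lia.
have -> : (maxn n m - minn n m == 0)%N = (m == n) by lia.
rewrite addn_eq0; case: (eqVneq m n) => [->|mn] /=.
  by case: (n == 0%N) => /=; rewrite ?mulr0n ?mulr1n ?mulr2n; lra.
have -> : ((n == 0) && (m == 0))%N = false by lia.
rewrite !mulr0n addr0 => /eqP; rewrite mulf_eq0 pnatr_eq0/= => /eqP ->.
by rewrite mul0rn.
Qed.

End discrete_cosines.

Section coefficients.
Context {R : realType} {w : weight R} {X : completeNormedModType R}.
Implicit Type u v : ell1 w X.

Lemma cheb_psum_coef (u : nat -> X) (n N K : nat) : (n <= N)%N -> (n + N < K)%N ->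
  \sum_(j < K) cos (node K j *+ n) *: cheb_psum u (cos (node K j : R)) N =
  K%:R *: u n.
Proof.
move=> nN nNK; under eq_bigr => j _.
  rewrite /cheb_psum scaler_sumr.
  under eq_bigr => i _.
    rewrite chebyshev_cos -scalerMnr scalerA scalerMnl; over.
  over.
rewrite exchange_big/=.
under eq_bigr => i _.
  rewrite -scaler_suml sumrMnl discrete_orthogonality; last first.
    by apply: leq_trans nNK; rewrite ltnS leq_add2l -ltnS.
  over.
rewrite (bigD1 (Ordinal (nN : (n < N.+1)%N)))//= eqxx mulr1n big1 ?addr0// => i.
by rewrite -val_eqE/= => /negPf ->; rewrite mulr0n scale0r.
Qed.

(** The [n]-th coefficient is the average of [u (cos t) cos (n t)] over
equidistant nodes, exactly for truncated series and up to the tail in general.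
Hence coefficients are controlled by values on [[-1, 1]], which in particular
makes a sequence determined by its function. *)
Lemma ell1_coef_le_sup u n (C : R) :
  (forall l, l \in `[-1, 1] -> `|ell1_fun u l| <= C) -> `|u n| <= C.
Proof.
move=> uC; apply/ler_addgt0Pr => e e0.
have [M _ uM] := ell1_trunc_approx u e0.
pose N := maxn n M; pose K := (n + N).+1.
have K0 : 0 < K%:R :> R by rewrite ltr0n.
rewrite -(ler_pM2l K0) -{1}[K%:R]gtr0_norm// -normrZ.
rewrite -(@cheb_psum_coef _ _ N) ?leq_maxl//.
apply: (le_trans (ler_norm_sum _ _ _)).
have -> : K%:R * (C + e) = \sum_(j < K) (C + e).
  by rewrite sumr_const card_ord mulr_natl.
apply: ler_sum => j _; rewrite normrZ.
apply: (@le_trans _ _ (1 * `|cheb_psum u (cos (node K j)) N|)).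
  by rewrite ler_wpM2r// cos_max.
rewrite mul1r -(ell1_fun_trunc (w := w)).
have l11 : cos (node K j : R) \in `[-1, 1] by rewrite in_itv/= cos_geN1 cos_le1.
have -> : ell1_trunc N u = u - (u - ell1_trunc N u) by rewrite subKr.
rewrite ell1_funB//; apply: (le_trans (ler_normB _ _)); apply: lerD.
  exact: uC.
apply: (le_trans (norm_ell1_fun_le _ l11)); apply: uM; exact: leq_maxr.
Qed.

Lemma ell1_fun_eq0 u : (forall l, l \in `[-1, 1] -> ell1_fun u l = 0) -> u = 0.
Proof.
move=> u0; apply: val_inj; apply/funext => n; apply/eqP; rewrite -normr_le0.
by apply: ell1_coef_le_sup => l l11; rewrite u0// normr0.
Qed.

End coefficients.

(** * Multiplication operators are bounded *)

Lemma homogeneous_norm_le (R : realType) (V W : normedModType R) (f : V -> W)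
    (C : R) : (forall a x, f (a *: x) = a *: f x) ->
  (forall x, `|x| <= 1 -> `|f x| <= C) -> forall x, `|f x| <= C * `|x|.
Proof.
move=> fZ fC x; have [->|x0] := eqVneq x 0.
  by rewrite -(scale0r 0) fZ !scale0r !normr0 mulr0.
have nx0 : 0 < `|x| by rewrite normr_gt0.
rewrite -ler_pdivrMr// mulrC -[`|x|^-1]gtr0_norm ?invr_gt0// -normrZ -fZ.
by apply: fC; rewrite normrZ normfV normr_id mulVf// gt_eqF.
Qed.

(** The uniform boundedness principle, with the bound in Lipschitz form. *)
Lemma uniform_operator_bound (R : realType) (V : completeNormedModType R)
    (W : normedModType R) (F : set (V -> W)) :
  (forall f, F f -> linear f) ->
  (forall f, F f -> exists M, forall x, `|f x| <= M * `|x|) ->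
  pointwise_bounded F ->
  exists2 C, 0 <= C & forall f, F f -> forall x, `|f x| <= C * `|x|.
Proof.
move=> Flin Fbnd Fpt.
have [f Ff|C FC] := Banach_Steinhauss _ Fpt 1.
  split; last exact: Flin.
  have [M fM] := Fbnd f Ff; move=> r; exists (`|M| * r) => x xr.
  apply: (le_trans (fM x)).
  by apply: le_trans (ler_wpM2r _ (ler_norm M)) (ler_wpM2l _ xr).
exists `|C| => // f Ff; apply: homogeneous_norm_le => [a x|x x1]; last first.
  exact: le_trans (FC f Ff x x1) (ler_norm C).
have := Flin f Ff a x 0; rewrite addr0 => ->.
have := Flin f Ff (-1) x x; rewrite !scaleN1r !addNr => ->.
by rewrite addr0.
Qed.

Section multiplication_operator.
Context {R : realType} {w : weight R} {Y X : completeNormedModType R}.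
Variables (A : R -> {linear Y -> X}) (AA : {linear ell1 w Y -> ell1 w X}).
Hypothesis A_bounded : forall l : R, l \in `[-1, 1] -> continuous (A l).
Hypothesis AA_A : multiplication_operator A AA.

(** Continuity of [AA] follows from that of the [A l] by uniform boundedness, used
twice. Testing [AA] on constants shows that the [A l]
are pointwise, hence uniformly, bounded, so that each coefficient of [AA psi]
depends continuously on [psi]. Then the truncations of [AA] are bounded
operators, pointwise bounded by [|AA psi|], hence uniformly bounded. *)
Lemma multiplication_operator_bound :
  exists C, forall psi, `|AA psi| <= C * `|psi|.
Proof.
have [C C0 AC] : exists2 C, 0 <= C & forall f : Y -> X,
    [set (A l : Y -> X) | l in [set l : R | l \in `[-1, 1]]] f ->
    forall y, `|f y| <= C * `|y|.
  apply: uniform_operator_bound.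
  - by move=> _ [l _ <-]; exact: linearP.
  - move=> _ [l /= l11 <-].
    have /linear_boundedP [M [Mr AM]] := continuous_linear_bounded 0 (A_bounded l11 (x := 0)).
    by exists (M + 1) => y; apply: AM; rewrite ltrDl.
  - move=> y; exists `|AA (ell1_const y)| => _ [l /= l11 <-].
    by rewrite -[y in A l y](ell1_fun_const (w := w) y l) -AA_A// norm_ell1_fun_le.
have {}AC l y : l \in `[-1, 1] -> `|A l y| <= C * `|y|.
  by move=> l11; apply: AC; exists l.
have coef_bound psi n : `|AA psi n| <= C * `|psi|.
  apply: ell1_coef_le_sup => l l11; rewrite AA_A//.
  by apply: (le_trans (AC _ _ l11)); rewrite ler_wpM2l// norm_ell1_fun_le.
have [D D0 truncD] : exists2 D, 0 <= D & forall f : ell1 w Y -> ell1 w X,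
    range (fun N : nat => (fun psi => ell1_trunc N (AA psi))) f ->
    forall psi, `|f psi| <= D * `|psi|.
  apply: uniform_operator_bound.
  - by move=> _ [N _ <-] a u v; rewrite linearP ell1_trunc_linear.
  - move=> _ [N _ <-]; exists (\sum_(n < N.+1) (C * w n) *+ (n != 0%N :> nat).+1).
    move=> psi; apply: (le_trans (norm_ell1_trunc_le _ _)).
    rewrite mulr_suml; apply: ler_sum => n _.
    rewrite mulrnAl lerMn2r; apply/orP; right.
    by rewrite mulrAC ler_wpM2r// ltW// weight_gt0.
  - move=> psi; exists `|AA psi| => _ [N _ <-].
    exact: le_trans (norm_ell1_trunc_le _ _) (ell1_psum_le _ _).
exists D => psi; apply: ell1_norm_le => N.
apply: (@le_trans _ _ `|ell1_trunc N (AA psi) : ell1 w X|).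
  by rewrite -(ell1_psum_trunc _ (leqnn N)); exact: (ell1_psum_le (ell1_trunc N (AA psi))).
by apply: (truncD (fun psi => ell1_trunc N (AA psi))); exists N.
Qed.

Lemma multiplication_operator_continuous : continuous AA.
Proof.
have [C AAC] := multiplication_operator_bound.
apply: bounded_linear_continuous; apply/linear_boundedP.
exists C; split; first exact: num_real.
move=> M CM psi; apply: (le_trans (AAC psi)); apply: ler_wpM2r => //.
exact: ltW.
Qed.

End multiplication_operator.

(** * The Newton-Kantorovich argument *)

Section newton_kantorovich.
Context {R : realType} {V : completeNormedModType R} {W : normedModType R}.
Variables (G : V -> W) (B : {linear W -> V}).
Hypothesis G_diff : forall x, differentiable G x.
Hypothesis B_cont : continuous B.

Definition newton_map (x : V) : V := x - B (G x).

Lemma newton_map_zero x : G x = 0 -> newton_map x = x.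
Proof. by move=> Gx; rewrite /newton_map Gx linear0 subr0. Qed.

Lemma newton_map_is_diff x :
  is_diff x newton_map (fun v => v - B ('d G x v)).
Proof.
have GD : is_diff x G ('d G x) by apply: DiffDef.
have BD : is_diff (G x) B B.
  apply: DiffDef; first exact/linear_differentiable.
  by rewrite diff_lin.
exact: is_diffB.
Qed.

Lemma newton_map_segment_derive x h (t : R) :
  is_derive t 1 (fun s => newton_map (x + s *: h)) (h - B ('d G (x + t *: h) h)).
Proof.
have pD : is_diff t (fun s : R => x + s *: h) (fun s => s *: h).
  apply: (is_diff_eq (is_diffD (is_diff_cst x t) (is_diff_scalel t h))).
  by apply/funext => s; rewrite /= add0r.
have cD := is_diff_comp pD (newton_map_is_diff (x + t *: h)).
apply: DeriveDef; first exact: diff_derivable.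
by rewrite deriveE// diff_val/= scale1r.
Qed.

Lemma quadratic_derive (a b t : R) :
  is_derive t 1 (fun s => a * s + b / 2 * s ^+ 2) (a + b * t).
Proof.
by apply: is_derive_eq; rewrite /GRing.scale/=; field.
Qed.

Variables (x0 : V) (r bY Z1 Z2 : R).
Hypothesis r_ge0 : 0 <= r.
Hypothesis Z1_ge0 : 0 <= Z1.
Hypothesis Z2_ge0 : 0 <= Z2.
Hypothesis hY : `|B (G x0)| <= bY.
Hypothesis hZ1 : forall v, `|v - B ('d G x0 v)| <= Z1 * `|v|.
Hypothesis hZ2 : forall x, `|x - x0| <= r ->
  forall v, `|B ('d G x v - 'd G x0 v)| <= Z2 * `|x - x0| * `|v|.

Lemma newton_derivative_bound x v : `|x - x0| <= r ->
  `|v - B ('d G x v)| <= (Z1 + Z2 * `|x - x0|) * `|v|.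
Proof.
move=> xr; rewrite mulrDl.
have -> : v - B ('d G x v) = (v - B ('d G x0 v)) - B ('d G x v - 'd G x0 v).
  by rewrite linearB opprB addrA subrK.
by apply: (le_trans (ler_normB _ _)); apply: lerD; [exact: hZ1|exact: hZ2].
Qed.

(** On the ball the derivative of the Newton map has norm at most
[Z1 + r Z2], and the ball is convex. *)
Lemma newton_map_lipschitz x y : `|x - x0| <= r -> `|y - x0| <= r ->
  `|newton_map y - newton_map x| <= (Z1 + r * Z2) * `|y - x|.
Proof.
move=> xr yr; pose k := (Z1 + r * Z2) * `|y - x|.
have seg t : t \in `[0, 1] -> `|x + t *: (y - x) - x0| <= r.
  rewrite in_itv/= => /andP[t0 t1].
  have -> : x + t *: (y - x) - x0 = (1 - t) *: (x - x0) + t *: (y - x0).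
    rewrite scalerBl scale1r -[RHS]addrA [- _ + _]addrC -scalerBr opprB addrA subrK.
    by rewrite addrAC.
  apply: (le_trans (ler_normD _ _)); rewrite !normrZ.
  rewrite (ger0_norm t0) ger0_norm ?subr_ge0//.
  have := ler_wpM2l t0 yr; have := @ler_wpM2l _ (1 - t) _ _ _ xr.
  rewrite subr_ge0 => /(_ t1); lra.
have := @mean_value_inequality _ _ (fun s => newton_map (x + s *: (y - x)))
  (fun t => (y - x) - B ('d G (x + t *: (y - x)) (y - x)))
  (fun s => k * s) (fun=> k) 0 1 ler01.
rewrite scale1r scale0r addr0 subrKC mulr0 mulr1 subr0; apply.
- by move=> t _; exact: newton_map_segment_derive.
- move=> t _; apply: is_derive_eq.
  by rewrite /GRing.scale/= mulr1.
- move=> t /seg tr; apply: (le_trans (newton_derivative_bound _ tr)).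
  by rewrite ler_wpM2r// lerD2l mulrC ler_wpM2r.
Qed.

Lemma newton_map_unique_zero x y : Z1 + r * Z2 < 1 ->
  `|x - x0| <= r -> `|y - x0| <= r -> G x = 0 -> G y = 0 -> x = y.
Proof.
move=> k1 xr yr /newton_map_zero Tx /newton_map_zero Ty.
apply/eqP; rewrite eq_sym -subr_eq0 -normr_le0 leNgt; apply/negP => xy.
by have := newton_map_lipschitz xr yr; rewrite Tx Ty leNgt gtr_pMl ?k1.
Qed.

(** Along the segment from the center the derivative is bounded by
[Z1 + Z2 t |x - x0|], whose integral yields the quadratic term. *)
Lemma newton_map_dist_center x : `|x - x0| <= r ->
  `|newton_map x - x0| <= bY + r * Z1 + r ^+ 2 / 2 * Z2.
Proof.
move=> xr; pose h := x - x0.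
have hr : `|h| <= r by [].
suff Th : `|newton_map x - newton_map x0| <=
    Z1 * `|h| + Z2 * `|h| ^+ 2 / 2.
  rewrite -(subrKA (newton_map x0)).
  apply: (le_trans (ler_normD _ _)).
  have -> : `|newton_map x0 - x0| = `|B (G x0)|.
    by rewrite /newton_map addrAC subrr sub0r normrN.
  have h2 : `|h| ^+ 2 <= r ^+ 2 by rewrite ler_pXn2r// nnegrE.
  have := ler_wpM2l Z1_ge0 hr; have := ler_wpM2l Z2_ge0 h2.
  move: hY Th; lra.
have seg t : t \in `[0, 1] -> `|x0 + t *: h - x0| = t * `|h|.
  by rewrite in_itv/= addrAC subrr add0r normrZ => /andP[/ger0_norm ->].
pose a := Z1 * `|h|; pose b := Z2 * `|h| ^+ 2.
have := @mean_value_inequality _ _ (fun s => newton_map (x0 + s *: h))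
  (fun t => h - B ('d G (x0 + t *: h) h))
  (fun s => a * s + b / 2 * s ^+ 2) (fun t => a + b * t) 0 1 ler01.
rewrite scale1r scale0r addr0 /h subrKC -/h mulr0 expr0n/= mulr0 addr0 subr0.
rewrite mulr1 expr1n mulr1; apply.
- by move=> t _; exact: newton_map_segment_derive.
- by move=> t _; exact: quadratic_derive.
- move=> t t01; have tr : `|x0 + t *: h - x0| <= r.
    rewrite seg//; apply: le_trans hr; move: t01; rewrite in_itv/= => /andP[t0 t1].
    by rewrite ler_piMl.
  apply: (le_trans (newton_derivative_bound _ tr)).
  by rewrite seg// /a /b; lra.
Qed.

Lemma newton_map_fixed_point : Z1 + r * Z2 < 1 ->
    bY + r * Z1 + r ^+ 2 / 2 * Z2 <= r ->
  exists2 x, `|x - x0| <= r & newton_map x = x.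
Proof.
move=> k1 kr; pose U := [set x | `|x - x0| <= r].
have k0 : 0 <= Z1 + r * Z2 by rewrite addr_ge0// mulr_ge0.
have TU : set_fun U U newton_map.
  by move=> x /= xr; apply: le_trans kr; exact: newton_map_dist_center.
pose T : {fun U >-> U} := HB.pack newton_map (isFun.Build _ _ _ _ _ TU).
have [x Ux xE] : exists2 x, U x & x = T x.
  apply: banach_fixed_point.
  - exists (NngNum k0); split => //= -[x y] /= [xr yr].
    exact: newton_map_lipschitz.
  - apply: closed_comp (@closed_le _ r) => x _.
    by apply: cvg_norm; apply: cvgB; [exact: cvg_id|exact: cvg_cst].
  - by exists x0; rewrite /U/= subrr normr0.
by exists x.
Qed.

End newton_kantorovich.

(** * Uniqueness at each parameter *)

Lemma opnorm_le (R : realType) (V W : normedModType R) (f : V -> W) (C : R) :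
  (forall a x, f (a *: x) = a *: f x) ->
  (opnorm f <= C%:E)%E -> forall x, `|f x| <= C * `|x|.
Proof.
move=> fZ fC; apply: homogeneous_norm_le => // x x1; rewrite -lee_fin.
by apply: le_trans fC; apply: ereal_sup_ubound; exists x.
Qed.

Section pointwise_zeros.
Context {R : realType} {w : weight R} {X Y : completeNormedModType R}.
Variables (F : X -> R -> Y) (FF : ell1 w X -> ell1 w Y).
Hypothesis FF_F : superposition_operator F FF.
Variables (A : R -> {linear Y -> X}) (AA : {linear ell1 w Y -> ell1 w X}).
Hypothesis A_inj : forall l : R, l \in `[-1, 1] -> injective (A l).
Hypothesis AA_A : multiplication_operator A AA.

(** Injectivity of each [A l] passes to [AA], because a sequence vanishes as soon
as its function does. *)
Lemma multiplication_operator_inj psi : AA psi = 0 -> psi = 0.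
Proof.
move=> AA0; apply: ell1_fun_eq0 => l l11; apply: (A_inj l11).
by rewrite -AA_A// AA0 ell1_fun0// linear0.
Qed.

Lemma newton_map_fixed_point_zero x : newton_map FF AA x = x -> FF x = 0.
Proof.
move=> Tx; apply: multiplication_operator_inj.
by rewrite -[LHS](subKr x) -/(newton_map FF AA x) Tx subrr.
Qed.

Variables (xbar : ell1 w X) (r k : R).
Hypothesis k_lt1 : k < 1.
Hypothesis T_lip : forall x y, `|x - xbar| <= r -> `|y - xbar| <= r ->
  `|newton_map FF AA y - newton_map FF AA x| <= k * `|y - x|.

(** If [F z l = 0], the sequence [x] obtained by adding to [xbar] the constant
[z - xbar l] satisfies [x l = z], lies as far from [xbar] as [z] from [xbar l],
and its image under the Newton map has value [z] at [l]. Two zeros thus lift to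
sequences at distance [|z1 - z2|], whose images under a strict contraction are
still at least that far apart. *)
Lemma superposition_unique_zero l (z1 z2 : X) : l \in `[-1, 1] ->
  `|z1 - ell1_fun xbar l| <= r -> `|z2 - ell1_fun xbar l| <= r ->
  F z1 l = 0 -> F z2 l = 0 -> z1 = z2.
Proof.
move=> l11.
pose lift z : ell1 w X := xbar + ell1_const (z - ell1_fun xbar l).
have liftl z : ell1_fun (lift z) l = z.
  by rewrite ell1_funD// ell1_fun_const subrKC.
have lift_ball z : `|z - ell1_fun xbar l| <= r -> `|lift z - xbar| <= r.
  by rewrite /lift addrAC subrr add0r norm_ell1_const.
have lift_dist z z' : `|lift z - lift z'| = `|z - z'|.
  have -> : lift z - lift z' = ell1_const (z - z').
    by rewrite /lift !ell1_constB opprD addrACA subrr add0r opprB addrA subrK.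
  exact: norm_ell1_const.
have T_lift z : F z l = 0 -> ell1_fun (newton_map FF AA (lift z)) l = z.
  by move=> Fz; rewrite ell1_funB// AA_A// FF_F// liftl Fz linear0 subr0.
move=> z1r z2r F1 F2; apply/eqP; rewrite -subr_eq0 -normr_le0 leNgt.
apply/negP => z12.
have := T_lip (lift_ball _ z2r) (lift_ball _ z1r).
rewrite lift_dist => /(le_trans (norm_ell1_fun_le _ l11)).
by rewrite ell1_funB// !T_lift// leNgt gtr_pMl ?k_lt1.
Qed.

End pointwise_zeros.

(** A tube of constant radius around the curve that contains no other zero
excludes bifurcation, since the curve is continuous. *)
Lemma not_bifurcates_isolated (R : realType) (w : weight R)
    (X Y : completeNormedModType R) (F : X -> R -> Y) (xs : ell1 w X) (e : R) :
  0 < e ->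
  (forall l z, l \in `[-1, 1] -> F z l = 0 -> `|z - ell1_fun xs l| < e ->
    z = ell1_fun xs l) ->
  ~ bifurcates F (ell1_fun xs).
Proof.
move=> e0 isol [l0 l011]; have e20 : 0 < e / 2 by rewrite divr_gt0.
pose B1 := [set z : X | `|ell1_fun xs l0 - z| < e / 2].
pose B2 := [set l : R | l \in `[-1, 1] ->
  `|ell1_fun xs l0 - ell1_fun xs l| < e / 2].
have B12 : nbhs (ell1_fun xs l0, l0) (B1 `*` B2).
  exists (B1, B2) => //; split => /=.
    by apply/nbhs_ballP; exists (e / 2) => //= z; rewrite -ball_normE.
  exact: ell1_fun_near.
move=> /(_ _ B12) [[z l] [[/= l11 Fz zl] [/= zB lB]]]; apply: zl.
apply: isol => //.
rewrite -(subrKA (ell1_fun xs l0)) (splitr e).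
apply: (le_lt_trans (ler_normD _ _)); rewrite distrC.
by apply: ltrD; [|exact: lB].
Qed.

Theorem theorem2p11 (R : realType) (w : weight R)
  (X Y : completeNormedModType R)
  (rstar : \bar R) (rstar_gt0 : (0 < rstar)%E) (xbar : ell1 w X)
  (F : X -> R -> Y) (FF : ell1 w X -> ell1 w Y)
  (FF_F : superposition_operator F FF)
  (FF_C1 : continuously_differentiable FF)
  (A : R -> {linear Y -> X})
  (A_bounded : forall l : R, l \in `[-1, 1] -> continuous (A l))
  (A_inj : forall l : R, l \in `[-1, 1] -> injective (A l))
  (AA : {linear ell1 w Y -> ell1 w X})
  (AA_A : multiplication_operator A AA)
  (bY Z1 Z2 : R) (bY_gt0 : 0 < bY) (Z1_gt0 : 0 < Z1) (Z2_gt0 : 0 < Z2)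
  (hY : `|AA (FF xbar)| <= bY)
  (hZ1 : (opnorm (idfun \- (AA \o 'd FF xbar))%R <= Z1%:E)%E)
  (hZ2 : forall x : ell1 w X, cball xbar rstar x ->
    (opnorm (AA \o ('d FF x \- 'd FF xbar))%R <= (Z2 * `|x - xbar|)%:E)%E)
  (r : R) (r_gt0 : 0 < r) (r_le : (r%:E <= rstar)%E)
  (hr : bY + r * Z1 + r ^+ 2 / 2 * Z2 < r)
  (hr' : Z1 + r * Z2 < 1) :
  exists xs : ell1 w X,
    [/\ unique (fun x : ell1 w X => cball xbar r%:E x /\ FF x = 0) xs,
        forall l : R, l \in `[-1, 1] ->
          unique (fun z : X => cball (ell1_fun xbar l) r%:E z /\ F z l = 0)
                 (ell1_fun xs l)
      & ~ bifurcates F (ell1_fun xs)].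
Proof.
have AA_cont := multiplication_operator_continuous A_bounded AA_A.
have FF_diff := FF_C1.1.
have bound1 v : `|v - AA ('d FF xbar v)| <= Z1 * `|v|.
  apply: (opnorm_le (f := (idfun \- (AA \o 'd FF xbar))%R)) => // a u /=.
  by rewrite scalerBr linearZ /= linearZ.
have bound2 x : `|x - xbar| <= r ->
    forall v, `|AA ('d FF x v - 'd FF xbar v)| <= Z2 * `|x - xbar| * `|v|.
  move=> xr; apply: (opnorm_le (f := (AA \o ('d FF x \- 'd FF xbar))%R)).
    by move=> a u /=; rewrite 2!linearZ /= -scalerBr linearZ.
  by apply: hZ2; rewrite /cball/=; apply: le_trans r_le; rewrite lee_fin.
have r_ge0 := ltW r_gt0; have Z1_ge0 := ltW Z1_gt0; have Z2_ge0 := ltW Z2_gt0.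
have T_lip := newton_map_lipschitz FF_diff AA_cont Z2_ge0 bound1 bound2.
have T_dist := newton_map_dist_center FF_diff AA_cont r_ge0 Z1_ge0 Z2_ge0 hY bound1 bound2.
have [xs xsr Txs] := newton_map_fixed_point FF_diff AA_cont r_ge0 Z1_ge0 Z2_ge0
  hY bound1 bound2 hr' (ltW hr).
have FFxs : FF xs = 0 by exact: (newton_map_fixed_point_zero A_inj AA_A Txs).
have xs_in : `|xs - xbar| < r.
  by rewrite -Txs; exact: le_lt_trans (T_dist _ xsr) hr.
have Fxs l : l \in `[-1, 1] -> F (ell1_fun xs l) l = 0.
  by move=> l11; rewrite -FF_F// FFxs ell1_fun0.
have xsl l : l \in `[-1, 1] -> `|ell1_fun xs l - ell1_fun xbar l| <= `|xs - xbar|.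
  by move=> l11; rewrite -ell1_funB// norm_ell1_fun_le.
have uniq_l l z : l \in `[-1, 1] -> `|z - ell1_fun xbar l| <= r -> F z l = 0 ->
    ell1_fun xs l = z.
  move=> l11 zr Fz.
  apply: (superposition_unique_zero FF_F AA_A hr' T_lip l11) => //.
    exact: le_trans (xsl _ l11) xsr.
  exact: Fxs.
exists xs; split.
- split; first by split => //; rewrite /cball/= lee_fin.
  move=> x [+ FFx]; rewrite /cball/= lee_fin => xr.
  exact: (newton_map_unique_zero FF_diff AA_cont Z2_ge0 bound1 bound2 hr' xsr xr).
- move=> l l11; split.
    by split; [rewrite /cball/= lee_fin; exact: le_trans (xsl _ l11) xsr|exact: Fxs].
  by move=> z [+ Fz]; rewrite /cball/= lee_fin => zr; exact: uniq_l.
(* [xs] lies in the open ball, which leaves room for a tube around it inside the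
   region where zeros are unique. *)
- apply: (@not_bifurcates_isolated _ _ _ _ _ _ (r - `|xs - xbar|)).
    by rewrite subr_gt0.
  move=> l z l11 Fz zxs; rewrite -(@uniq_l l z)//.
  rewrite -(subrKA (ell1_fun xs l)); apply: (le_trans (ler_normD _ _)).
  by have := xsl l l11; lra.
Qed.
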